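(* Let $\mu$ be a $T$-invariant probability measure on $\Omega$ which is (right) $\phi$-mixing with respect to a generating partition $\mathcal{A}$ that is at most countably infinite. Assume that $\phi(j)$ is summable, i.e. $\sum_j\phi(j)<\infty$. If $x\in\Omega$ is not periodic (and $\mu(A_n(x))>0$ for all $n$), then for every $k\in\mathbb{N}$ $$\mathbb{P}\left(\tau_{A_n(x)}^k>\frac{t}{\mu(A_n(x))}\right)\longrightarrow\sum_{i=0}^{k-1}e^{-t}\frac{t^i}{i!}$$ as $n\to\infty$, for all $t>0$.
   Context: $T:\Omega\to\Omega$ is a measurable map of a probability space with $T$-invariant probability measure $\mu$; $\mathbb{P}=\mu$. $\mathcal{A}$ is a finite or countably infinite measurable partition of $\Omega$, $\mathcal{A}^n=\bigvee_{j=0}^{n-1}T^{-j}\mathcal{A}$ (its elements are the $n$-cylinders); $\sigma(\mathcal{A}^n)$ consists of all unions of $n$-cylinders. $\mathcal{A}$ is generating: the atoms of $\mathcal{A}^\infty$ are single points. $A_n(x)$ denotes the element of $\mathcal{A}^n$ containing $x$. A point $x$ is periodic if $T^px=x$ for some $p\ge1$. $\mu$ is (right) $\phi$-mixing with respect to $\mathcal{A}$ if there is a decreasing sequence $\phi(k)\to0$ ($k\to\infty$) such that $$\left|\frac{\mu(B\cap T^{-n-k}(B'))}{\mu(B')}-\mu(B)\right|\le\phi(k)$$ for all $n\ge1$, $k\ge0$, $B\in\sigma(\mathcal{A}^n)$ and $B'\in\sigma(\bigcup_{\ell\ge1}\mathcal{A}^\ell)$ with $\mu(B')>0$. Hitting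 times: $\tau_A(x)=\inf\{k\ge1:T^k(x)\in A\}$ (with $\inf\emptyset=\infty$), $\tau_A^1=\tau_A$, and $\tau_A^k(x)=\inf\{\ell>\tau_A^{k-1}(x):T^\ell(x)\in A\}$ for $k>1$. *)

(* Defs.v *)
From HB Require Import structures.
From mathcomp Require Import all_boot all_order all_algebra.
From mathcomp Require Import all_classical all_reals all_analysis.

Set Implicit Arguments.
Unset Strict Implicit.
Unset Printing Implicit Defensive.

Import Order.TTheory GRing.Theory Num.Theory.
Import numFieldNormedType.Exports.

Local Open Scope classical_set_scope.
Local Open Scope ring_scope.

Section cylinders.
Context {Omega : Type} (T : Omega -> Omega) (A : set (set Omega)).

(* The join of the partitions T^{-j}A for j in J; as in any join of
   partitions, only the nonempty intersections are kept. *)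
Definition dyn_join (J : set nat) : set (set Omega) :=
  [set C | C !=set0 /\
    exists2 a : nat -> set Omega, (forall j, J j -> A (a j)) &
      C = \bigcap_(j in J) (iter j T @^-1` a j)].

Definition cylinders (n : nat) : set (set Omega) := dyn_join `I_n.

Definition cylinder_at (n : nat) (x : Omega) : set Omega :=
  pblock (cylinders n) id x.

Definition generating : Prop :=
  forall C, dyn_join [set: nat] C -> exists x, C = [set x].

Definition periodic_point (x : Omega) : Prop :=
  exists2 p : nat, (1 <= p)%N & iter p T x = x.

End cylinders.

Definition countable_measurable_partition {d} {Omega : measurableType d}
    (A : set (set Omega)) : Prop :=
  [/\ partition A id [set: Omega], countable A &
      forall a, A a -> measurable a].

Definition invariant_measure {d} {Omega : measurableType d} {R : realType}
    (T : Omega -> Omega) (mu : probability Omega R) : Prop :=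
  forall E, measurable E -> mu (T @^-1` E) = mu E.

Definition right_phi_mixing {d} {Omega : measurableType d} {R : realType}
    (T : Omega -> Omega) (A : set (set Omega)) (mu : probability Omega R)
    (phi : R^nat) : Prop :=
  [/\ nonincreasing_seq phi, phi @ \oo --> 0 &
      forall (n k : nat) (B B' : set Omega), (1 <= n)%N ->
        <<s cylinders T A n >> B ->
        <<s \bigcup_(l in [set l | (1 <= l)%N]) cylinders T A l >> B' ->
        (0 < mu B')%E ->
        `| fine (mu (B `&` (iter (n + k) T @^-1` B'))) / fine (mu B')
           - fine (mu B) | <= phi k].

(* Hitting times take values in the extended reals, where ereal_inf set0
   is +oo. *)
Definition hitting_time {Omega : Type} (R : realType) (T : Omega -> Omega)
    (E : set Omega) (x : Omega) : \bar R :=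
  ereal_inf [set l%:R%:E | l in [set l : nat | (1 <= l)%N /\ E (iter l T x)]].

(* Meaningful for k >= 1, with value hitting_time at k = 1. *)
Definition kth_hitting_time {Omega : Type} (R : realType) (T : Omega -> Omega)
    (E : set Omega) (k : nat) (x : Omega) : \bar R :=
  iter k.-1
    (fun s : \bar R => ereal_inf
       [set l%:R%:E | l in [set l : nat | (s < l%:R%:E)%E /\ E (iter l T x)]])
    (hitting_time R T E x).

(* Main.v *)
(* Let E be the n-cylinder around x, a = mu(E), and let W_M count the visits to E
   at times 1..M; then tau^k > s iff W_M < k for M = floor s. By invariance,
     P(W_(M+1) < k+1) = P(W_M < k+1) - P(E /\ W_M = k),
   and mixing across a gap g replaces the last term by a P(W_M = k), up to an error
     P(E /\ W_g > 0) + phi(g - n) + g a^2.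
   If this error is at most a eta, then M |-> P(W_M < k) obeys the recursion of the
   binomial distribution function of parameters (M, a) up to a eta at each step, so
   after about t/a steps the two differ by at most t eta, and the binomial converges
   to Poisson. To make eta small take g of order eps/a: summability of phi gives
   g phi(g) --> 0, hence phi(g - n) = o(a); visits to E shortly after time 0 are
   excluded because x is not periodic, and those at times j up to g have probability
   at most a (a + mu(A_(j/2)(x)) + phi(j/2)) by right mixing, which is summable since
   the measure of cylinders around x decays exponentially. *)
Require Import Defs.
From HB Require Import structures.
From mathcomp Require Import all_boot all_order all_algebra.
From mathcomp Require Import all_classical all_reals all_analysis.
From mathcomp Require Import lra zify ring.

Set Implicit Arguments.
Unset Strict Implicit.
Unset Printing Implicit Defensive.

Import Order.TTheory GRing.Theory Num.Theory.
Import numFieldNormedType.Exports.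

Local Open Scope classical_set_scope.
Local Open Scope ring_scope.

(** * Cylinders and itineraries *)

Section itineraries.
Context {Omega : Type} (T : Omega -> Omega) (A : set (set Omega)).
Hypothesis A_part : partition A id [set: Omega].

Lemma pblock_partition y : A (pblock A id y) /\ pblock A id y y.
Proof.
case: A_part => cov _ _; have [a Aa ay] : cover A id y by rewrite cov.
exact: (getI (P := fun i => A i /\ i y) (conj Aa ay)).
Qed.

Lemma partition_eq a b y : A a -> A b -> a y -> b y -> a = b.
Proof.
by case: A_part => _ triv _ Aa Ab ay b_y; apply: triv => //; exists y.
Qed.

Lemma pblock_unique a y : A a -> a y -> pblock A id y = a.
Proof.
by move=> Aa ay; have [Ab b_y] := pblock_partition y; exact: partition_eq b_y ay.
Qed.

Lemma dyn_join_pblock (J : set nat) y :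
  dyn_join T A J (\bigcap_(j in J) (iter j T @^-1` pblock A id (iter j T y))).
Proof.
split; first by exists y => j _ /=; case: (pblock_partition (iter j T y)).
by exists (fun j => pblock A id (iter j T y)) => // j _;
  case: (pblock_partition (iter j T y)).
Qed.

(** [pblock] picks some element of the join that contains [y]; disjointness of the blocks forces its
    symbol at each time [j] to be the block of [T^j y]. *)
Lemma cylinder_atE n y :
  cylinder_at T A n y =
    \bigcap_(j in `I_n) (iter j T @^-1` pblock A id (iter j T y)).
Proof.
set C := RHS.
have Cy : C y by move=> j _ /=; case: (pblock_partition (iter j T y)).
have [/= [_ [a Aa D_E]] Dy] := getI (P := fun D => cylinders T A n D /\ D y)
  (conj (dyn_join_pblock `I_n y) Cy).
rewrite /cylinder_at /pblock /pblock_index D_E.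
apply: eq_bigcapr => j jn; congr (_ @^-1` _).
by apply/esym/pblock_unique; [exact: Aa|move: Dy; rewrite D_E => /(_ _ jn)].
Qed.

Lemma in_cylinder_at n y z : cylinder_at T A n y z <->
  forall j, (j < n)%N -> pblock A id (iter j T z) = pblock A id (iter j T y).
Proof.
rewrite cylinder_atE; split=> [Cz j jn|Cz j jn /=].
  by apply: pblock_unique; [case: (pblock_partition (iter j T y))|exact: Cz].
by rewrite -Cz//; case: (pblock_partition (iter j T z)).
Qed.

Lemma cylinders_cylinder_at n y : cylinders T A n (cylinder_at T A n y).
Proof. by rewrite cylinder_atE; exact: dyn_join_pblock. Qed.

Lemma cylinder_at_sub m n y : (m <= n)%N ->
  cylinder_at T A n y `<=` cylinder_at T A m y.
Proof.
move=> mn z /in_cylinder_at Cz; apply/in_cylinder_at => j jm.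
by apply: Cz; exact: leq_trans mn.
Qed.

Lemma cylinder_at_shift m s y : cylinder_at T A (m + s) y `<=`
  iter s T @^-1` cylinder_at T A m (iter s T y).
Proof.
move=> z /in_cylinder_at Cz; apply/in_cylinder_at => j jm.
by rewrite -!iterD Cz// ltn_add2r.
Qed.

Hypothesis A_gen : generating T A.

(** Prescribing the symbols at all times gives an element of the infinite join, which is a single
    point because the partition is generating. *)
Lemma itinerary_inj y z :
  (forall j, pblock A id (iter j T z) = pblock A id (iter j T y)) -> z = y.
Proof.
move=> zy; have [w Ew] := A_gen (dyn_join_pblock setT y).
suff yz u : (forall j, pblock A id (iter j T u) = pblock A id (iter j T y)) -> u = w.
  by rewrite (yz z zy) (yz y).
move=> uy; suff : [set w] u by [].
by rewrite -Ew => j _ /=; rewrite -uy; case: (pblock_partition (iter j T u)).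
Qed.

(* If the cylinders met their [j]-th preimages for arbitrarily large [n], then
   [x] and [T^j x] would have the same itinerary. *)
Lemma no_short_return x r : ~ periodic_point T x ->
  exists n0, forall n j, (n0 <= n)%N -> (1 <= j <= r)%N ->
    cylinder_at T A n x `&` iter j T @^-1` cylinder_at T A n x = set0.
Proof.
move=> xnper.
have one j : (1 <= j)%N -> exists n0, forall n, (n0 <= n)%N ->
    cylinder_at T A n x `&` iter j T @^-1` cylinder_at T A n x = set0.
  move=> j1; apply: contrapT => none; apply: xnper; exists j => //.
  apply: itinerary_inj => i; apply: contrapT => ne.
  apply: none; exists (i + j).+1 => n n_ge.
  apply/seteqP; split=> // z [/in_cylinder_at z0 /in_cylinder_at zj].
  by apply: ne; rewrite -iterD -(z0 (i + j)%N)// iterD zj//; lia.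
elim: r => [|r [n0 IH]]; first by exists 0%N => n j _; lia.
have [n1 H1] := one r.+1 isT.
exists (maxn n0 n1) => n j; rewrite geq_max => /andP[n0n n1n] /andP[j1].
by rewrite leq_eqVlt => /predU1P[->|jr]; [exact: H1|apply: IH => //; rewrite j1].
Qed.

End itineraries.

(** * Binomial distribution functions and the Poisson limit *)

Section binomial_cdf.
Context {R : realType}.

Definition binomial_term (a : R) (M i : nat) : R :=
  'C(M, i)%:R * a ^+ i * (1 - a) ^+ (M - i).

Definition binomial_cdf (a : R) (k M : nat) : R :=
  \sum_(0 <= i < k) binomial_term a M i.

Lemma binomial_termS0 a M : binomial_term a M.+1 0 = (1 - a) * binomial_term a M 0.
Proof. by rewrite /binomial_term !bin0 !subn0 !expr0 !mul1r exprS. Qed.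

Lemma binomial_termSS a M i : binomial_term a M.+1 i.+1 =
  (1 - a) * binomial_term a M i.+1 + a * binomial_term a M i.
Proof.
rewrite /binomial_term binS subSS natrD; have [iM|Mi] := ltnP i M.
  rewrite -(subSS i) subSn// !exprS.
  by move: ('C(M, i.+1)%:R) ('C(M, i)%:R) (a ^+ i) ((1 - a) ^+ (M - i.+1)) => *; ring.
by rewrite (bin_small (m := i.+1)) ?ltnS// !mul0r mulr0 !add0r exprS; ring.
Qed.

Lemma binomial_cdf0 a k : binomial_cdf a k.+1 0 = 1.
Proof.
rewrite /binomial_cdf big_nat_recl// big1 ?addr0 => [|i _];
  by rewrite /binomial_term ?bin0 ?bin0n ?subnn ?expr0 ?mul1r ?mul0r.
Qed.

Lemma binomial_cdf_recr a k M :
  binomial_cdf a k.+1 M = binomial_cdf a k M + binomial_term a M k.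
Proof. by rewrite /binomial_cdf big_nat_recr. Qed.

Lemma binomial_cdfS a k M : binomial_cdf a k.+1 M.+1 =
  (1 - a) * binomial_cdf a k.+1 M + a * binomial_cdf a k M.
Proof.
elim: k => [|k IH].
  by rewrite /binomial_cdf !big_nat1 big_geq// mulr0 addr0 binomial_termS0.
by rewrite 2!(binomial_cdf_recr _ k.+1) IH binomial_termSS (binomial_cdf_recr _ k); ring.
Qed.

(* Both sides vanish when [M <= i], thanks to truncated subtraction. *)
Lemma binomial_term_step a M i : a != 1 -> binomial_term a M i.+1 =
  binomial_term a M i * ((M - i)%:R * a / (i.+1%:R * (1 - a))).
Proof.
move=> a1; have a1' : 1 - a != 0 by rewrite subr_eq0 eq_sym.
have i0 : i.+1%:R != 0 :> R by rewrite pnatr_eq0.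
have := mul_bin_left M i => /(congr1 (fun n => n%:R : R)); rewrite !natrM => bE.
rewrite /binomial_term; have [Mi|iM] := leqP M i.
  by rewrite (bin_small (m := i.+1)) ?ltnS// (eqP Mi) !mul0r mulr0.
have -> : 'C(M, i.+1)%:R = (M - i)%:R * 'C(M, i)%:R / i.+1%:R :> R.
  by rewrite -bE mulrAC divff// mul1r.
rewrite -(subSS i) subSn// !exprS.
move: (i.+1%:R) i0 ((M - i.+1).+1%:R) ('C(M, i)%:R) (a ^+ i) ((1 - a) ^+ (M - i.+1)).
by move=> d d0 *; field; rewrite a1' d0.
Qed.

(* The errors [d k M] satisfy
   [d k.+1 M.+1 <= (1 - a) d k.+1 M + a d k M + a eta], a convex combination up to
   the last term. *)
Lemma binomial_cdf_approx (a eta : R) (G : nat -> nat -> R) : 0 <= a <= 1 ->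
  (forall M, G 0%N M = 0) -> (forall k, G k.+1 0%N = 1) ->
  (forall k M, `|G k.+1 M.+1 - ((1 - a) * G k.+1 M + a * G k M)| <= a * eta) ->
  forall k M, `|G k M - binomial_cdf a k M| <= M%:R * (a * eta).
Proof.
move=> /andP[a0 a1] G0 Gk0 GS k M.
have eta0 : 0 <= a * eta by apply: le_trans (GS 0%N 0%N); exact: normr_ge0.
elim: M k => [|M IH] [|k].
- by rewrite G0 /binomial_cdf big_geq// subrr normr0 mul0r.
- by rewrite Gk0 binomial_cdf0 subrr normr0 mul0r.
- by rewrite G0 /binomial_cdf big_geq// subrr normr0 mulr_ge0.
rewrite binomial_cdfS.
have -> : G k.+1 M.+1 - ((1 - a) * binomial_cdf a k.+1 M + a * binomial_cdf a k M) =
    (G k.+1 M.+1 - ((1 - a) * G k.+1 M + a * G k M)) +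
    ((1 - a) * (G k.+1 M - binomial_cdf a k.+1 M) + a * (G k M - binomial_cdf a k M)).
  by ring.
apply: le_trans (ler_normD _ _) _; apply: le_trans (lerD (GS _ _) (ler_normD _ _)) _.
rewrite !normrM (ger0_norm a0) (ger0_norm (x := 1 - a)) ?subr_ge0//.
have := ler_wpM2l a0 (IH k); have := @ler_wpM2l _ (1 - a) _ _ _ (IH k.+1).
by rewrite subr_ge0 a1 -natr1 => /(_ isT); nra.
Qed.

End binomial_cdf.

Section poisson_limit.
Context {R : realType} (a : R^nat) (t : R).
Hypothesis a_gt0 : forall n, 0 < a n.
Hypothesis a_to0 : a @ \oo --> 0.
Hypothesis t_gt0 : 0 < t.

Let N n := Num.truncn (t / a n).

Let cvg_one_minus : 1 - a n @[n --> \oo] --> (1 : R).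
Proof.
by rewrite -[X in _ --> X]subr0; apply: cvgB; [exact: cvg_cst|exact: a_to0].
Qed.

Lemma truncn_div_mul_cvg : (N n)%:R * a n @[n --> \oo] --> t.
Proof.
have tt : t - a n @[n --> \oo] --> t.
  by rewrite -[X in _ --> X]subr0; apply: cvgB; [exact: cvg_cst|exact: a_to0].
apply: (squeeze_cvgr _ tt (cvg_cst t)); apply: nearW => n.
have /andP[N1 N2] := truncn_itv (divr_ge0 (ltW t_gt0) (ltW (a_gt0 n))).
move: N1 N2; rewrite -/(N n) ler_pdivlMr// ltr_pdivrMr// -natr1 => -> /ltW.
by rewrite andbT mulrDl mul1r; lra.
Qed.

(** Squeeze by powers of [exp (- a / (1 - a)) <= 1 - a <= exp (- a)]; both outer exponents tend to
    [- t] since [N a] tends to [t]. The lower bound is [1 + u <= exp u] at [u = a / (1 - a)],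
    inverted. *)
Lemma exp_truncn_cvg : (1 - a n) ^+ N n @[n --> \oo] --> expR (- t).
Proof.
have Na := truncn_div_mul_cvg.
have a1 := cvg_one_minus.
have lo : expR (- ((N n)%:R * a n / (1 - a n))) @[n --> \oo] --> expR (- t).
  apply: continuous_cvg; first exact: continuous_expR.
  apply: cvgN; rewrite -[X in _ --> X]divr1; apply: cvgM => //.
  exact: cvgV (oner_neq0 _) a1.
have hi : expR (- ((N n)%:R * a n)) @[n --> \oo] --> expR (- t).
  by apply: continuous_cvg; [exact: continuous_expR|exact: cvgN].
apply: (squeeze_cvgr _ lo hi).
near=> n.
have an1 : 0 < 1 - a n by near: n; exact: (cvgr_gt 1 a1 0 ltr01).
apply/andP; split.
  rewrite -mulrA -mulrN expRM_natl lerXn2r ?nnegrE ?expR_ge0 ?(ltW an1)//.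
  rewrite expRN -[leRHS]invrK lef_pV2 ?posrE ?expR_gt0 ?invr_gt0//.
  apply: le_trans (expR_ge1Dx _).
  by rewrite le_eqVlt; apply/orP; left; apply/eqP; field; rewrite gt_eqF.
rewrite -mulrN expRM_natl lerXn2r ?nnegrE ?expR_ge0 ?(ltW an1)//.
exact: expR_ge1Dx.
Unshelve. all: by end_near. Qed.

(** Induction on [i]: the ratio of consecutive terms tends to [t / (i + 1)], so only [i = 0] needs
    the exponential limit. *)
Lemma binomial_term_cvg i :
  binomial_term (a n) (N n) i @[n --> \oo] --> expR (- t) * (t ^+ i / i`!%:R).
Proof.
elim: i => [|i IH].
  rewrite expr0 fact0 divr1 mulr1 /binomial_term.
  under eq_fun do rewrite bin0 expr0 !mul1r subn0.
  exact: exp_truncn_cvg.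
have a1 := cvg_one_minus.
have step : (N n - i)%:R * a n / (i.+1%:R * (1 - a n)) @[n --> \oo] --> t / i.+1%:R.
  rewrite -[X in _ / X]mulr1; apply: cvgM; last first.
    apply: cvgV; first by rewrite mulr1 pnatr_eq0.
    by apply: cvgM => //; exact: cvg_cst.
  (* Truncation at 0 can only increase [N n - i], so the untruncated difference bounds it from
     below. *)
  have lo : (N n)%:R * a n - i%:R * a n @[n --> \oo] --> t.
    rewrite -[X in _ --> X]subr0; apply: cvgB; first exact: truncn_div_mul_cvg.
    by rewrite -(mulr0 i%:R); apply: cvgM; [exact: cvg_cst|exact: a_to0].
  apply: (squeeze_cvgr _ lo truncn_div_mul_cvg); apply: nearW => n.
  rewrite -mulrBl !ler_pM2r// ler_nat leq_subr andbT lerBlDr -natrD ler_nat.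
  by rewrite addnC -leq_subLR.
have -> : expR (- t) * (t ^+ i.+1 / i.+1`!%:R) =
    expR (- t) * (t ^+ i / i`!%:R) * (t / i.+1%:R).
  rewrite factS natrM exprS invfM.
  by move: (i.+1%:R^-1) (i`!%:R^-1) (t ^+ i) => *; ring.
apply: cvg_trans (cvgM IH step).
apply: near_eq_cvg; near=> n; apply/esym/binomial_term_step.
rewrite eq_sym -subr_eq0 gt_eqF//; near: n; exact: (cvgr_gt 1 a1 0 ltr01).
Unshelve. all: by end_near. Qed.

Lemma binomial_cdf_cvg k : binomial_cdf (a n) k (N n) @[n --> \oo] -->
  \sum_(0 <= i < k) expR (- t) * (t ^+ i / i`!%:R).
Proof.
elim: k => [|k IH].
  by rewrite big_geq// /binomial_cdf; under eq_fun do rewrite big_geq//; exact: cvg_cst.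
rewrite big_nat_recr//=; under eq_fun do rewrite binomial_cdf_recr.
by apply: cvgD IH _; exact: binomial_term_cvg.
Qed.

End poisson_limit.

(** * Summable sequences *)

Lemma addn_divn2_le j : (j %/ 2 + j %/ 2 <= j)%N.
Proof. by have := leq_divM j 2; lia. Qed.

Lemma ltn_mul4_divn2 j : (0 < j %/ 2)%N -> (j < 4 * (j %/ 2))%N.
Proof. by have := divn_eq j 2; have := @ltn_pmod j 2 isT; lia. Qed.

Section summable.
Context {R : realType}.
Implicit Types u : R^nat.

Lemma divn_cvgy s : (0 < s)%N -> (n %/ s)%N @[n --> \oo] --> \oo.
Proof.
move=> s0; apply/cvgnyPge => K; near=> n.
by rewrite leq_divRL//; near: n; exact: nbhs_infty_ge.
Unshelve. all: by end_near. Qed.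

Lemma nonincreasing_cvg0_ge0 u : nonincreasing_seq u -> u @ \oo --> 0 ->
  forall n, 0 <= u n.
Proof.
move=> u_dec u0 n; rewrite -(cvg_lim _ u0)//.
by apply: nonincreasing_cvgn_ge => //; apply: cvgP u0.
Qed.

(** Monotonicity gives [n u_n <= 2 (u_(n/2) + ... + u_(n-1))], and this block of a convergent series
    tends to 0. *)
Lemma summable_nonincreasing_cvg0 u : nonincreasing_seq u -> (forall n, 0 <= u n) ->
  cvgn (series u) -> n%:R * u n @[n --> \oo] --> 0.
Proof.
move=> u_dec u_ge0 su.
have d0 : 2%:R * (series u n - series u (n %/ 2)%N) @[n --> \oo] --> 0.
  rewrite -(mulr0 2%:R) -(subrr (limn (series u))).
  apply: cvgM; [exact: cvg_cst|apply: cvgB => //].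
  exact: cvg_comp (@divn_cvgy 2 isT) su.
apply: (squeeze_cvgr _ (cvg_cst 0) d0); apply: nearW => n.
rewrite mulr_ge0//= -[leRHS]mulrC.
have n2 : (n %/ 2 <= n)%N by exact: leq_div.
rewrite /series/= (big_cat_nat (leq0n _) n2)//= addrAC subrr add0r.
apply: (@le_trans _ _ (\sum_(n %/ 2 <= i < n) u n * 2%:R)).
  rewrite sumr_const_nat -[leRHS]mulr_natr -mulrA [leLHS]mulrC ler_wpM2l// -natrM ler_nat.
  by have := divn_eq n 2; have := @ltn_pmod n 2 isT; lia.
rewrite mulr_suml ler_sum_nat// => i /andP[_ i_n].
by rewrite ler_wpM2r// u_dec// ltnW.
Qed.

(** Each value of [u] is repeated [s] times, so the partial sums stay below [s] times the sum of
    [u]. *)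
Lemma summable_nondecreasing_index u s : (0 < s)%N -> (forall n, 0 <= u n) ->
  cvgn (series u) -> cvgn (series (fun n => u (n %/ s)%N)).
Proof.
move=> s0 u_ge0 su.
have blocks M : \sum_(0 <= j < M * s) u (j %/ s)%N = s%:R * \sum_(0 <= i < M) u i.
  elim: M => [|M IH]; first by rewrite !big_geq// mulr0.
  rewrite (@big_cat_nat _ _ _ (M * s)) ?leq_mul// IH big_nat_recr//= mulrDr; congr (_ + _).
  transitivity (\sum_(M * s <= j < M.+1 * s) u M); last first.
    by rewrite sumr_const_nat -mulnBl subSnn mul1n -[LHS]mulr_natl.
  apply: eq_big_nat => j /andP[j1 j2]; congr u; apply/eqP.
  by rewrite eqn_leq leq_divRL// j1 andbT -ltnS ltn_divLR.
apply: nondecreasing_is_cvgn; first by apply: nondecreasing_series => n _ _.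
exists (s%:R * limn (series u)) => _ [M _ <-].
apply: (@le_trans _ _ (\sum_(0 <= j < M * s) u (j %/ s)%N)).
  rewrite /series/= (@big_cat_nat _ _ _ M 0 (M * s))//=; last by rewrite leq_pmulr.
  by rewrite lerDl sumr_ge0.
rewrite blocks ler_wpM2l//; apply: nondecreasing_cvgn_le => //.
exact: nondecreasing_series.
Qed.

Lemma summable_tail u : (forall n, 0 <= u n) -> cvgn (series u) ->
  forall e, 0 < e -> exists r, forall g, \sum_(r <= j < g) u j <= e.
Proof.
move=> u_ge0 su e e0.
have sinc : nondecreasing_seq (series u) by exact: nondecreasing_series.
have /cvgrPdist_le/(_ _ e0)[r _ /(_ r (leqnn r))/= Hr] := su.
exists r => g; have [rg|/ltnW gr] := leqP r g; last by rewrite big_geq// ltW.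
apply: le_trans Hr; apply: le_trans (ler_norm _); rewrite lerBrDr addrC.
apply: le_trans (nondecreasing_cvgn_le sinc su g).
by rewrite /series/= (big_cat_nat (leq0n _) rg).
Qed.

End summable.

(** * Counting visits *)

Section hit_count.
Context {R : realType} {Omega : Type} (T : Omega -> Omega) (E : set Omega).

Definition hit_count (M : nat) (y : Omega) : nat :=
  \sum_(l < M) `[< E (iter l.+1 T y) >].

Lemma hit_count0 y : hit_count 0 y = 0%N.
Proof. by rewrite /hit_count big_ord0. Qed.

Lemma hit_countSr M y : hit_count M.+1 y = (hit_count M y + `[< E (iter M.+1 T y) >])%N.
Proof. by rewrite /hit_count big_ord_recr. Qed.

(** Splitting off time 1 instead of time [M.+1] writes the count as a function of [T y], so that
    invariance of the measure can act on it. *)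
Lemma hit_countS M y : hit_count M.+1 y = (`[< E (T y) >] + hit_count M (T y))%N.
Proof.
rewrite /hit_count big_ord_recl; congr (_ + _)%N.
by apply: eq_bigr => i _; rewrite -iterSr.
Qed.

(** No visit is lost by starting the clock at time [g]. For [M <= g] truncated subtraction makes
    both sides 0. *)
Lemma hit_count_shift g M y : hit_count g y = 0%N ->
  hit_count M y = hit_count (M - g) (iter g T y).
Proof.
elim: g M y => [|g IH] [|M] y; rewrite ?subn0// ?sub0n ?hit_count0//.
rewrite !hit_countS => /eqP; rewrite addn_eq0 => /andP[/eqP -> /eqP /IH ->].
by rewrite subSS iterSr.
Qed.

Lemma hit_count_gt0 g y : (0 < hit_count g y)%N ->
  exists2 j, (1 <= j <= g)%N & E (iter j T y).
Proof.
elim: g => [|g IH]; first by rewrite hit_count0.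
rewrite hit_countSr; case: asboolP => [Ey _|_]; first by exists g.+1 => //; rewrite leqnn.
by rewrite addn0 => /IH[j /andP[j1 jg] Ej]; exists j => //; rewrite j1 leqW.
Qed.

Lemma le_ereal_inf_natP (P : set nat) M :
  ((M%:R%:E <= ereal_inf [set (l%:R%:E : \bar R) | l in P])%E : Prop) <->
  forall l, P l -> (M <= l)%N.
Proof.
split=> [MP l Pl|MP]; last first.
  by apply: le_ereal_inf_tmp => _ [l Pl <-]; rewrite lee_fin ler_nat MP.
have : (M%:R%:E <= l%:R%:E :> \bar R)%E.
  by apply: le_trans MP _; apply: ereal_inf_lbound; exists l.
by rewrite lee_fin ler_nat.
Qed.

(** The candidates are integers, so exceeding [s] means reaching [floor s + 1]. The weak form can be
    tested element by element, also for empty [P], where the infimum is infinite. *)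
Lemma lt_ereal_inf_natP (P : set nat) (s : R) : 0 <= s ->
  (s%:E < ereal_inf [set (l%:R%:E : \bar R) | l in P])%E =
  ((Num.truncn s).+1%:R%:E <= ereal_inf [set (l%:R%:E : \bar R) | l in P])%E.
Proof.
move=> s0; have /andP[ts st] := truncn_itv s0.
apply/idP/idP => [sP|]; last by apply: lt_le_trans; rewrite lte_fin.
apply/le_ereal_inf_natP => l Pl.
have : (s%:E < l%:R%:E)%E.
  by apply: lt_le_trans sP _; apply: ereal_inf_lbound; exists l.
by rewrite lte_fin -(ltr_nat R); exact: le_lt_trans.
Qed.

Lemma kth_hitting_timeS k y : kth_hitting_time R T E k.+2 y = ereal_inf
  [set l%:R%:E | l in [set l : nat |
    (kth_hitting_time R T E k.+1 y < l%:R%:E)%E /\ E (iter l T y)]].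
Proof. by []. Qed.

(** Induction on [k]: the previous case says that time [l.+1] comes after visit [k.+1] exactly when
    more than [k] visits occur up to [l] ([ltS]). A visit at such a time therefore raises the count
    to at least [k.+2]. *)
Lemma le_kth_hitting_time k M y :
  ((M.+1%:R%:E <= kth_hitting_time R T E k.+1 y)%E : Prop) <->
  (hit_count M y <= k)%N.
Proof.
elim: k M => [|k IH] M.
  rewrite /kth_hitting_time /hitting_time/= le_ereal_inf_natP leqn0.
  split=> [MP|/eqP W0 l [l1 El]].
    rewrite eqn0Ngt; apply/negP => /hit_count_gt0[j /andP[j1 jM] Ej].
    by have := MP j (conj j1 Ej); rewrite ltnNge jM.
  rewrite ltnNge; apply/negP => lM; move/eqP: W0; apply/negP.
  rewrite -lt0n; elim: M lM => [|M IHM]; first by case: l l1 {El}.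
  rewrite leq_eqVlt hit_countSr => /predU1P[<-|/IHM]; first by rewrite (asboolT El) addn1.
  by rewrite addn_gt0 => ->.
have ltS l : ((kth_hitting_time R T E k.+1 y < l.+1%:R%:E)%E : Prop) <-> (k < hit_count l y)%N.
  by rewrite ltNge ltnNge; split=> /negP H; apply/negP => /IH.
(* Excludes time 0 as a candidate, which [ltS] does not cover. *)
have lt0 : ~ (kth_hitting_time R T E k.+1 y < 0%:R%:E)%E.
  apply/negP; rewrite -leNgt; apply: (@le_trans _ _ 1%:R%:E); first by rewrite lee_fin.
  by apply/IH; rewrite hit_count0.
rewrite kth_hitting_timeS le_ereal_inf_natP; split.
  elim: M => [|M IHM] MP; first by rewrite hit_count0.
  have WM : (hit_count M y <= k.+1)%N by apply: IHM => l /MP; exact: ltnW.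
  rewrite hit_countSr; case: asboolP => [Ey|_]; last by rewrite addn0.
  rewrite addn1 ltnS leqNgt; apply/negP => /ltS kW.
  by have := MP M.+1 (conj kW Ey); rewrite ltnn.
move=> WM [|l] [kl El]; first by case: (lt0 kl).
rewrite ltnNge; apply/negP => lM; move/ltS: kl => kl.
suff : (k.+1 < hit_count M y)%N by rewrite ltnNge WM.
elim: M lM {WM} => // M IHM.
rewrite leq_eqVlt hit_countSr => /predU1P[[<-]|]; first by rewrite (asboolT El) addn1.
by rewrite ltnS => /IHM /leq_trans; apply; exact: leq_addr.
Qed.

Lemma lt_kth_hitting_time k (s : R) y : 0 <= s ->
  ((s%:E < kth_hitting_time R T E k.+1 y)%E : Prop) <->
  (hit_count (Num.truncn s) y < k.+1)%N.
Proof.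
move=> s0; rewrite ltnS -le_kth_hitting_time.
by case: k => [|k]; rewrite ?kth_hitting_timeS /kth_hitting_time/= ?/hitting_time
  lt_ereal_inf_natP.
Qed.

End hit_count.

(** * Mixing estimates *)

Section probability_real.
Context {d} {Omega : measurableType d} {R : realType} (mu : probability Omega R).
Local Notation P X := (fine (mu X)).

Lemma prob_ge0 X : 0 <= P X.
Proof. exact/fine_ge0/measure_ge0. Qed.

Lemma prob_fin_num X : measurable X -> mu X \is a fin_num.
Proof. exact: fin_num_measure. Qed.

Lemma prob_le X Y : measurable X -> measurable Y -> X `<=` Y -> P X <= P Y.
Proof.
by move=> mX mY XY; rewrite fine_le ?prob_fin_num// le_measure ?inE.
Qed.

Lemma prob_setT : P [set: Omega] = 1.
Proof. by rewrite probability_setT. Qed.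

Lemma prob_le1 X : measurable X -> P X <= 1.
Proof. by move=> mX; rewrite -prob_setT prob_le. Qed.

Lemma prob_setU X Y : measurable X -> measurable Y -> X `&` Y = set0 ->
  P (X `|` Y) = P X + P Y.
Proof. by move=> mX mY XY; rewrite measureU// fineD ?prob_fin_num. Qed.

Lemma prob_setDI X Y : measurable X -> measurable Y -> P X = P (X `\` Y) + P (X `&` Y).
Proof.
move=> mX mY; have mD := measurableD mX mY; have mI := measurableI _ _ mX mY.
by rewrite (measureDI mu mX mY) fineD ?prob_fin_num.
Qed.

Lemma prob_leU X Y Z : measurable X -> measurable Y -> measurable Z ->
  X `<=` Y `|` Z -> P X <= P Y + P Z.
Proof.
move=> mX mY mZ XYZ; have mD := measurableD mX mY; have mI := measurableI _ _ mX mY.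
rewrite (prob_setDI mX mY) addrC; apply: lerD; apply: prob_le => //.
by move=> y [/XYZ[]].
Qed.

Lemma prob_dist_le X Y Z : measurable X -> measurable Y -> measurable Z ->
  X `\` Y `<=` Z -> Y `\` X `<=` Z -> `|P X - P Y| <= P Z.
Proof.
move=> mX mY mZ XYZ YXZ.
have le_add U V : measurable U -> measurable V -> U `\` V `<=` Z -> P U <= P V + P Z.
  move=> mU mV UVZ; apply: prob_leU => // y Uy.
  by have [Vy|nVy] := pselect (V y); [left|right; exact: UVZ].
by rewrite ler_distlC lerBlDr !le_add.
Qed.

End probability_real.

(** * Events generated by cylinders and the mixing inequality *)

Section right_mixing.
Context {R : realType} {d} {Omega : measurableType d} (mu : probability Omega R).
Context (T : Omega -> Omega) (A : set (set Omega)) (phi : R^nat).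
Hypothesis T_meas : measurable_fun [set: Omega] T.
Hypothesis mu_inv : invariant_measure T mu.
Hypothesis A_part : countable_measurable_partition A.

Local Notation P X := (fine (mu X)).
Local Notation cylinder_sigma :=
  <<s \bigcup_(l in [set l | (1 <= l)%N]) cylinders T A l >>.

Let part : partition A id [set: Omega]. Proof. by case: A_part. Qed.

Lemma measurable_preimage X : measurable X -> measurable (T @^-1` X).
Proof. by move=> mX; rewrite -[X in measurable X]setTI; exact: T_meas. Qed.

Lemma iter_preimageS n X : iter n.+1 T @^-1` X = T @^-1` (iter n T @^-1` X).
Proof. by apply/seteqP; split => y; rewrite /preimage/= -iterSr. Qed.

Lemma measurable_iter_preimage n X : measurable X -> measurable (iter n T @^-1` X).
Proof.
elim: n => // n IH mX; rewrite iter_preimageS.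
exact/measurable_preimage/IH.
Qed.

Lemma prob_iter_preimage n X : measurable X -> P (iter n T @^-1` X) = P X.
Proof.
elim: n => // n IH mX; rewrite iter_preimageS.
by rewrite mu_inv ?IH//; exact: measurable_iter_preimage.
Qed.

Lemma measurable_cylinders n C : cylinders T A n C -> measurable C.
Proof.
case: A_part => _ _ mA [_ [a Aa ->]].
apply: bigcap_measurableType => // j jn.
exact/measurable_iter_preimage/mA/Aa.
Qed.

Lemma measurable_cylinder_at n y : measurable (cylinder_at T A n y).
Proof. exact/measurable_cylinders/cylinders_cylinder_at. Qed.

Lemma cylinder_sigma_measurable X : cylinder_sigma X -> measurable X.
Proof.
apply: smallest_sub; first exact: sigma_algebra_measurable.
by move=> C [l _]; exact: measurable_cylinders.
Qed.

Lemma cylinder_sigmaT : cylinder_sigma [set: Omega].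
Proof. exact: (@measurableT _ (g_sigma_algebraType _)). Qed.

Lemma cylinder_sigma0 : cylinder_sigma set0.
Proof. exact: (@measurable0 _ (g_sigma_algebraType _)). Qed.

Lemma cylinder_sigmaC X : cylinder_sigma X -> cylinder_sigma (~` X).
Proof. exact: (@measurableC _ (g_sigma_algebraType _)). Qed.

Lemma cylinder_sigmaI X Y : cylinder_sigma X -> cylinder_sigma Y -> cylinder_sigma (X `&` Y).
Proof. exact: (@measurableI _ (g_sigma_algebraType _)). Qed.

Lemma cylinder_sigmaU X Y : cylinder_sigma X -> cylinder_sigma Y -> cylinder_sigma (X `|` Y).
Proof. exact: (@measurableU _ (g_sigma_algebraType _)). Qed.

Lemma cylinder_sigma_cylinder_at n y : cylinder_sigma (cylinder_at T A n y).
Proof.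
(* The generators start at [l = 1]; the 0-cylinder is the whole space and is treated apart. *)
case: n => [|n]; last first.
  by apply: sub_sigma_algebra; exists n.+1 => //; exact: cylinders_cylinder_at.
have -> : cylinder_at T A 0 y = [set: Omega]; last exact: cylinder_sigmaT.
by apply/seteqP; split=> // z _; apply/(in_cylinder_at T part).
Qed.

(* The preimage of an [l]-cylinder is a countable union of [(l+1)]-cylinders. *)
Lemma cylinder_sigma_preimage X : cylinder_sigma X -> cylinder_sigma (T @^-1` X).
Proof.
move: X; apply: smallest_sub.
  split=> [|X SX|F SF]; rewrite /= ?preimage_set0.
  - exact: cylinder_sigma0.
  - by rewrite setTD preimage_setC; exact: cylinder_sigmaC.
  - by rewrite preimage_bigcup; exact: (@bigcupT_measurable _ (g_sigma_algebraType _)).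
move=> C [l _ [Cne [a Aa CE]]] /=.
have -> : T @^-1` C = \bigcup_(b in A) (b `&` T @^-1` C).
  apply/seteqP; split=> [y Cy|y [b _ []//]].
  by have [Ab b_y] := pblock_partition part y; exists (pblock A id y).
have SF b : A b -> cylinder_sigma (b `&` T @^-1` C); last first.
  case: A_part => _; rewrite -(eq_countable (card_setT A)) => cA _; rewrite (bigcup_set_type A).
  have SF' (b : A) : cylinder_sigma (val b `&` T @^-1` C).
    by case: b => b /=; rewrite inE => /SF.
  exact: (@countable_bigcupT_measurable _ (g_sigma_algebraType _) _ _ cA SF').
move=> Ab.
have [[y y_in]|/set0P/negP/negPn/eqP ->] := pselect ((b `&` T @^-1` C) !=set0); last first.
  exact: cylinder_sigma0.
apply: sub_sigma_algebra; exists l.+1 => //; split; first by exists y.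
(* The symbols of [C] delayed by one step, with [b] as the new symbol at time 0. *)
exists (fun j => if j is j'.+1 then a j' else b) => [[|j] jl//|]; first exact: Aa.
rewrite CE; apply/seteqP; split=> z.
  by move=> [bz Cz] [|j] jl //=; rewrite -iterS iterSr; exact: Cz.
move=> H; split; first exact: (H 0%N).
by move=> j jl; have /= := H j.+1 jl; rewrite -iterS iterSr.
Qed.

(** Mixing speaks only of events generated by cylinders, so the count events must be shown to be of
    this kind, not merely measurable. *)
Lemma cylinder_sigma_hit_count E : cylinder_sigma E ->
  forall M k, cylinder_sigma [set y | hit_count T E M y = k].
Proof.
move=> SE; elim=> [|M IH] k.
  have [->|k0] := eqVneq k 0%N.
    have -> : [set y | hit_count T E 0 y = 0%N] = [set: Omega]; last exact: cylinder_sigmaT.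
    by apply/seteqP; split=> // y _; exact: hit_count0.
  have -> : [set y | hit_count T E 0 y = k] = set0; last exact: cylinder_sigma0.
  by apply/seteqP; split=> // y /=; rewrite hit_count0 => k_0; case/eqP: k0.
have -> : [set y | hit_count T E M.+1 y = k] =
    T @^-1` ((E `&` [set y | (hit_count T E M y).+1 = k]) `|`
             (~` E `&` [set y | hit_count T E M y = k])).
  apply/seteqP; split=> y /=; rewrite hit_countS; case: asboolP => Ey.
  - by left.
  - by right.
  - by case=> [[]|[]].
  - by case=> [[]|[]].
apply: cylinder_sigma_preimage; apply: cylinder_sigmaU; apply: cylinder_sigmaI => //.
  case: k => [|k].
    have -> : [set y | (hit_count T E M y).+1 = 0%N] = set0; last exact: cylinder_sigma0.
    by apply/seteqP; split.
  have -> // : [set y | (hit_count T E M y).+1 = k.+1] = [set y | hit_count T E M y = k].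
  by apply/seteqP; split=> y /= => [[]|->].
exact: cylinder_sigmaC.
Qed.

Hypothesis mu_mix : right_phi_mixing T A mu phi.

Lemma phi_ge0 n : 0 <= phi n.
Proof. by case: mu_mix => phi_dec phi0 _; exact: nonincreasing_cvg0_ge0. Qed.

(** The mixing bound cleared of its denominator; for a null [X] invariance makes both terms vanish.
    The factor [P X] on the right is what later makes return probabilities proportional to the
    measure of the target. *)
Lemma cylinder_mixing m j y X : (1 <= m <= j)%N -> cylinder_sigma X ->
  `|P (cylinder_at T A m y `&` iter j T @^-1` X) - P (cylinder_at T A m y) * P X|
    <= phi (j - m)%N * P X.
Proof.
move=> /andP[m1 mj] SX; have mX := cylinder_sigma_measurable SX.
have mC := measurable_cylinder_at m y.
have mTX := measurable_iter_preimage j mX.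
have [_ _ /(_ m (j - m)%N (cylinder_at T A m y) X m1)] := mu_mix.
rewrite subnKC// => mix.
have [X0|X0] := eqVneq (P X) 0.
  rewrite X0 !mulr0 subr0 ger0_norm ?prob_ge0// -X0 -(prob_iter_preimage j mX).
  by apply: prob_le => //; exact: measurableI.
have PX : 0 < P X by rewrite lt_neqAle eq_sym X0 prob_ge0.
have mX0 : (0 < mu X)%E by rewrite -[mu X]fineK ?prob_fin_num// lte_fin.
have := mix (sub_sigma_algebra (cylinders_cylinder_at T part m y)) SX mX0.
rewrite -(ler_pM2r PX) -[X in _ * X <= _ -> _](gtr0_norm PX) -normrM mulrBl.
by rewrite divfK// gt_eqF.
Qed.

Lemma cylinder_sigma_hit_count_lt E : cylinder_sigma E ->
  forall M k, cylinder_sigma [set y | (hit_count T E M y < k)%N].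
Proof.
move=> SE M; elim=> [|k IH].
  have -> : [set y | (hit_count T E M y < 0)%N] = set0; last exact: cylinder_sigma0.
  by apply/seteqP; split.
have -> : [set y | (hit_count T E M y < k.+1)%N] =
    [set y | (hit_count T E M y < k)%N] `|` [set y | hit_count T E M y = k].
  apply/seteqP; split=> y /=.
    by rewrite ltnS leq_eqVlt => /predU1P[|]; [right|left].
  by move=> [/leqW|->].
by apply: cylinder_sigmaU => //; exact: cylinder_sigma_hit_count.
Qed.

Lemma measurable_hit_count_gt0 E g : cylinder_sigma E ->
  measurable [set y | (0 < hit_count T E g y)%N].
Proof.
move=> SE; have -> : [set y | (0 < hit_count T E g y)%N] =
    ~` [set y | (hit_count T E g y < 1)%N].
  by apply/seteqP; split=> y /=; rewrite ltnS leqn0 lt0n => /negP.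
apply/measurableC/cylinder_sigma_measurable.
exact: cylinder_sigma_hit_count_lt.
Qed.

(** Union bound over the time of a visit. It serves with [C] the cylinder itself, for returns, and
    with [C] the whole space. *)
Lemma prob_hit_count_gt0 C E g : measurable C -> cylinder_sigma E ->
  P (C `&` [set y | (0 < hit_count T E g y)%N]) <=
  \sum_(1 <= j < g.+1) P (C `&` iter j T @^-1` E).
Proof.
move=> mC SE; have mE := cylinder_sigma_measurable SE; elim: g => [|g IH].
  rewrite big_geq//.
  have -> : C `&` [set y | (0 < hit_count T E 0 y)%N] = set0.
    by apply/seteqP; split=> // y [_ /=]; rewrite hit_count0.
  by rewrite measure0.
rewrite big_nat_recr//=; apply: le_trans (lerD IH (lexx _)).
apply: prob_leU; try by apply: measurableI => //; exact: measurable_hit_count_gt0.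
  by apply: measurableI => //; exact: (measurable_iter_preimage g.+1).
move=> y [Cy] /=; rewrite hit_countSr; case: asboolP => [Ey _|_]; first by right.
by rewrite addn0; left.
Qed.

(** * Approximate binomial recursion for the visits to a fixed cylinder *)

Section cylinder_hits.
Context (x : Omega) (n g : nat).
Hypothesis n_gt0 : (1 <= n)%N.
Hypothesis n_le_g : (n <= g)%N.

Let E := cylinder_at T A n x.
Let a := P E.
Let SE : cylinder_sigma E. Proof. exact: cylinder_sigma_cylinder_at. Qed.
Let mE : measurable E. Proof. exact: measurable_cylinder_at. Qed.

(** The summands pay in turn for forgetting early visits inside [E] ([e1]), for mixing across the
    gap ([e2]), and for restoring those visits in the factor without [E] ([e3]). *)
Let err := P (E `&` [set y | (0 < hit_count T E g y)%N]) + phi (g - n)%N + a * (g%:R * a).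

(* The hits at times [1..g] are forgotten before mixing is applied across the gap. *)
Lemma hit_count_mixing M k :
  `|P (E `&` [set y | hit_count T E M y = k]) - a * P [set y | hit_count T E M y = k]|
    <= err.
Proof.
set X := [set y | _ = _]; set X' := [set y | hit_count T E (M - g) y = k].
set Y := iter g T @^-1` X'; set Z := [set y | (0 < hit_count T E g y)%N].
have SX' : cylinder_sigma X' by exact: cylinder_sigma_hit_count.
have mX' := cylinder_sigma_measurable SX'.
have mX : measurable X by apply: cylinder_sigma_measurable; exact: cylinder_sigma_hit_count.
have mY : measurable Y by exact: measurable_iter_preimage.
have mZ : measurable Z by exact: measurable_hit_count_gt0.
have XY y : ~ Z y -> X y <-> Y y.
  rewrite /X /Y /Z /X'/= => /negP; rewrite -eqn0Ngt => /eqP Wg.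
  by rewrite (hit_count_shift M Wg).
have XYZ : X `\` Y `<=` Z.
  by move=> y [Xy nYy]; apply: contrapT => nZ; apply: nYy; exact: (XY y nZ).1.
have YXZ : Y `\` X `<=` Z.
  by move=> y [Yy nXy]; apply: contrapT => nZ; apply: nXy; exact: (XY y nZ).2.
have e1 : `|P (E `&` X) - P (E `&` Y)| <= P (E `&` Z).
  apply: prob_dist_le; try exact: measurableI.
    by move=> y [[Ey Xy] nEY]; split=> //; apply: XYZ; split=> // Yy; exact: nEY.
  by move=> y [[Ey Yy] nEX]; split=> //; apply: YXZ; split=> // Xy; exact: nEX.
have e2 : `|P (E `&` Y) - a * P X'| <= phi (g - n)%N.
  apply: le_trans (cylinder_mixing _ _ SX') _; first by rewrite n_gt0.
  by rewrite ler_piMr ?phi_ge0 ?prob_le1.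
have PZ : P Z <= g%:R * a.
  rewrite -[Z]setTI; apply: le_trans (prob_hit_count_gt0 _ measurableT SE) _.
  rewrite (eq_bigr (fun=> a)) => [|j _]; last by rewrite setTI prob_iter_preimage.
  by rewrite sumr_const_nat subn1 -[leLHS]mulr_natl.
have e3 : `|a * P X' - a * P X| <= a * (g%:R * a).
  rewrite -mulrBr normrM (ger0_norm (prob_ge0 mu E)) ler_wpM2l ?prob_ge0//.
  rewrite -(prob_iter_preimage g mX'); apply: le_trans PZ.
  exact: prob_dist_le.
have -> : P (E `&` X) - a * P X = (P (E `&` X) - P (E `&` Y)) +
    (P (E `&` Y) - a * P X') + (a * P X' - a * P X) by ring.
apply: le_trans (ler_normD _ _) (lerD _ e3).
exact: le_trans (ler_normD _ _) (lerD e1 e2).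
Qed.

Lemma hit_count_cdf_step k M :
  `|P [set y | (hit_count T E M.+1 y < k.+1)%N] -
    ((1 - a) * P [set y | (hit_count T E M y < k.+1)%N] +
     a * P [set y | (hit_count T E M y < k)%N])| <= err.
Proof.
pose G M k := [set y | (hit_count T E M y < k)%N].
(* The event at [M.+1] is the preimage of [U] under [T], so it has the same probability. [U] arises
   from [G M k.+1] by removing the points of [E] with exactly [k] visits ([UE]). *)
pose U := [set y | (`[< E y >] + hit_count T E M y < k.+1)%N].
pose X := [set y | hit_count T E M y = k].
rewrite -/(G M.+1 k.+1) -/(G M k.+1) -/(G M k).
have mG M' k' : measurable (G M' k').
  apply: cylinder_sigma_measurable; exact: cylinder_sigma_hit_count_lt.
have mX : measurable X by apply: cylinder_sigma_measurable; exact: cylinder_sigma_hit_count.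
have mEX : measurable (E `&` X) by exact: measurableI.
have UE : U = G M k.+1 `\` (E `&` X).
  apply/seteqP; split=> y; rewrite /U /G /X /=; case: asboolP => Ey.
  - by rewrite add1n ltnS => Wk; split; [exact: ltnW|move=> [_ Wk']; move: Wk; rewrite Wk' ltnn].
  - by move=> Wk; split=> // -[].
  - rewrite add1n ltnS => -[]; rewrite ltnS leq_eqVlt => /predU1P[Wk []//|].
    by [].
  - by rewrite add0n => -[].
have mU : measurable U by rewrite UE; exact: measurableD.
have -> : P (G M.+1 k.+1) = P U.
  rewrite -(prob_iter_preimage 1 mU); congr (P _).
  by apply/seteqP; split=> y; rewrite /G /U /= hit_countS.
have PU : P (G M k.+1) = P U + P (E `&` X).
  rewrite (prob_setDI _ (mG M k.+1) mEX) -UE; congr (_ + P _).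
  by apply/seteqP; split=> [y []//|y [Ey Xy]]; split=> //; rewrite /G /= Xy.
have PX : P (G M k.+1) = P (G M k) + P X.
  rewrite -prob_setU//; last first.
    by apply/seteqP; split=> // y [] /=; rewrite /G /X /= => Wk Wk'; move: Wk; rewrite Wk' ltnn.
  congr (P _); apply/seteqP; split=> y; rewrite /G /X /=.
    by rewrite ltnS leq_eqVlt => /predU1P[|]; [right|left].
  by move=> [/leqW|->].
have -> : P U - ((1 - a) * P (G M k.+1) + a * P (G M k)) =
    - (P (E `&` X) - a * P X) by move: PU PX => -> PX; nra.
by rewrite normrN; exact: hit_count_mixing.
Qed.

End cylinder_hits.

(** * Decay of the cylinders around a non-periodic point, short returns, and the limit law *)

Section nonperiodic_point.
Context (x : Omega).
Hypothesis A_gen : generating T A.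
Hypothesis x_nonper : ~ periodic_point T x.
Hypothesis x_pos : forall n, (0 < mu (cylinder_at T A n x))%E.

Let h m := P (cylinder_at T A m x).

Lemma prob_cylinder_at_gt0 m : 0 < h m.
Proof. by rewrite -lte_fin fineK ?prob_fin_num//; exact: measurable_cylinder_at. Qed.

Lemma prob_cylinder_at_decr : nonincreasing_seq h.
Proof.
move=> m p mp; apply: prob_le; try exact: measurable_cylinder_at.
exact: cylinder_at_sub.
Qed.

Let mA a : A a -> measurable a. Proof. by case: A_part => _ _; apply. Qed.

Lemma prob_partition_le a b : A a -> A b -> a <> b -> P a + P b <= 1.
Proof.
move=> Aa Ab ab; rewrite -prob_setU; try exact: mA.
  by apply/prob_le1/measurableU; exact: mA.
apply/seteqP; split=> // y [ay b_y]; apply: ab.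
exact: (partition_eq part) ay b_y.
Qed.

(* An atom of full measure would contain the whole orbit of [x], making [x] a
   fixed point. *)
Lemma prob_partition_lt1 a : A a -> P a < 1.
Proof.
move=> Aa; rewrite lt_neqAle prob_le1 ?andbT; last exact: mA.
apply/eqP => Pa1; apply: x_nonper; exists 1%N => //=.
have orbit_a i : pblock A id (iter i T x) = a.
  apply: contrapT => ne; have [Ab b_y] := pblock_partition part (iter i T x).
  (* A second block on the orbit would have positive measure, since its [i]-th preimage contains the
     [i.+1]-cylinder around [x]; no mass is left for it beside [a]. *)
  have := prob_partition_le Ab Aa ne; rewrite Pa1 gerDr leNgt => /negP; apply.
  apply: lt_le_trans (prob_cylinder_at_gt0 i.+1) _.
  rewrite -(prob_iter_preimage i (mA Ab)); apply: prob_le.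
  - exact: measurable_cylinder_at.
  - exact/measurable_iter_preimage/mA.
  - move=> z /(in_cylinder_at T part)/(_ i (ltnSn i)) <-.
    by case: (pblock_partition part (iter i T z)).
by apply: (itinerary_inj part A_gen) => j; rewrite -iterSr !orbit_a.
Qed.

(** The bound is uniform even for infinitely many blocks: if one block exceeds 1/2, all others are
    below 1/2. *)
Lemma prob_partition_bounded : exists2 q : R, q < 1 & forall a, A a -> P a <= q.
Proof.
have [[a [Aa a_gt]]|none] := pselect (exists a, A a /\ 1 / 2 < P a); last first.
  exists (1 / 2); first lra.
  by move=> a Aa; rewrite leNgt; apply/negP => a_gt; apply: none; exists a.
exists (P a) => [|b Ab]; first exact: prob_partition_lt1.
have [->//|ba] := pselect (b = a).
by have := prob_partition_le Ab Aa ba; lra.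
Qed.

(** Keep one symbol out of every [k.+1]. Each kept symbol costs a factor [q0 + phi k], and [k] is
    chosen so that this is at most [(1 + q0) / 2 < 1]. *)
Lemma prob_cylinder_at_decay : exists s q, [/\ (0 < s)%N, 0 <= q < 1 &
  forall m, h m <= q ^+ (m %/ s)].
Proof.
have [q0 q0_lt q0P] := prob_partition_bounded.
have q0_ge0 : 0 <= q0.
  by have [Ab _] := pblock_partition part x; apply: le_trans (q0P _ Ab); exact: prob_ge0.
have [_ phi0 _] := mu_mix.
have e0 : 0 < (1 - q0) / 2 by lra.
have /cvgrPdist_le/(_ _ e0)[k _ /(_ k (leqnn k))/=] := phi0.
rewrite sub0r normrN ger0_norm ?phi_ge0// => phik.
exists k.+1, ((1 + q0) / 2); split=> //; first by apply/andP; split; lra.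
have step i m : P (cylinder_at T A (m + k.+1) (iter i T x)) <=
    (1 + q0) / 2 * P (cylinder_at T A m (iter (k.+1 + i) T x)).
  set D := cylinder_at T A m _.
  have SD : cylinder_sigma D by exact: cylinder_sigma_cylinder_at.
  have mD := cylinder_sigma_measurable SD.
  set C1 := cylinder_at T A 1 (iter i T x).
  have C1q : P C1 <= q0.
    have [Ab _] := pblock_partition part (iter i T x).
    apply: le_trans (q0P _ Ab); apply: prob_le; [exact: measurable_cylinder_at|exact: mA|].
    by move=> z /(in_cylinder_at T part)/(_ 0%N isT)/= <-; case: (pblock_partition part z).
  apply: (@le_trans _ _ (P (C1 `&` iter k.+1 T @^-1` D))).
    apply: prob_le; first exact: measurable_cylinder_at.
      by apply: measurableI; [exact: measurable_cylinder_at|exact: (measurable_iter_preimage k.+1)].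
    move=> z Cz; split; first by apply: (cylinder_at_sub part) Cz; rewrite addnS.
    by have := cylinder_at_shift part Cz; rewrite -iterD.
  have := cylinder_mixing (iter i T x) (isT : 1 <= 1 <= k.+1)%N SD.
  rewrite subSS subn0 -/C1 ler_norml => /andP[_].
  have PD := prob_ge0 mu D.
  by have := ler_wpM2r PD C1q; have := ler_wpM2r PD phik; nra.
(* The centre moves along the orbit of [x], so the induction runs over all [i]; [r] is a leftover
   length, bounded trivially. *)
have iter_step p r i : P (cylinder_at T A (r + p * k.+1) (iter i T x)) <= ((1 + q0) / 2) ^+ p.
  elim: p i => [|p IH] i; first by apply: prob_le1; exact: measurable_cylinder_at.
  rewrite mulSn addnCA addnC exprS; apply: le_trans (step _ _) _.
  by rewrite ler_wpM2l//; lra.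
move=> m; have := iter_step (m %/ k.+1)%N (m %% k.+1)%N 0%N.
by rewrite addnC -divn_eq.
Qed.

Lemma summable_prob_cylinder_at : cvgn (series h).
Proof.
have [s [q [s0 /andP[q0 q1] hq]]] := prob_cylinder_at_decay.
have hge0 m : 0 <= h m by exact: prob_ge0.
have qn_ge0 (n : nat) : 0 <= q ^+ n by exact: exprn_ge0.
apply: series_le_cvg hge0 _ hq _ => [m|]; first exact: qn_ge0.
apply: (summable_nondecreasing_index (u := fun n => q ^+ n)) => //.
have <- : geometric 1 q = (fun n => q ^+ n) by apply/funext => n; rewrite /geometric/= mul1r.
by apply: is_cvg_geometric_series; rewrite ger0_norm.
Qed.

Lemma prob_cylinder_at_cvg0 : h @ \oo --> 0.
Proof. exact: cvg_series_cvg_0 summable_prob_cylinder_at. Qed.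

(* Only the first [min n (j / 2)] symbols of the earlier visit are retained, which
   leaves a mixing gap of at least [j / 2] before the later one. *)
Lemma prob_return n j : (1 <= n)%N -> (2 <= j)%N ->
  P (cylinder_at T A n x `&` iter j T @^-1` cylinder_at T A n x) <=
  h n * (h n + (h (j %/ 2)%N + phi (j %/ 2)%N)).
Proof.
move=> n1 j2; set E := cylinder_at T A n x; set m := minn n (j %/ 2)%N.
have SE : cylinder_sigma E by exact: cylinder_sigma_cylinder_at.
have mE := cylinder_sigma_measurable SE.
have j2' : (1 <= j %/ 2)%N by rewrite leq_divRL.
have m1 : (1 <= m)%N by rewrite /m leq_min n1.
have mj : (m <= j %/ 2)%N by exact: geq_minr.
have jj := addn_divn2_le j.
have mj' : (1 <= m <= j)%N by rewrite m1 (leq_trans mj)// leq_div.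
have hm : h m <= h n + h (j %/ 2)%N.
  by rewrite /m; case: leqP => _; rewrite ?lerDl ?lerDr prob_ge0.
have phim : phi (j - m)%N <= phi (j %/ 2)%N.
  by case: mu_mix => phi_dec _ _; apply: phi_dec; lia.
apply: (@le_trans _ _ (P (cylinder_at T A m x `&` iter j T @^-1` E))).
  apply: prob_le; try by apply: measurableI;
    [exact: measurable_cylinder_at|exact: measurable_iter_preimage].
  by move=> y [Ey Ty]; split=> //; apply: (cylinder_at_sub part) Ey; exact: geq_minl.
have := cylinder_mixing x mj' SE; rewrite ler_norml -/(h m) -/(h n) => /andP[_].
have hn := prob_ge0 mu E; rewrite -/(h n) in hn.
by have := ler_wpM2r hn hm; have := ler_wpM2r hn phim; nra.
Qed.

Hypothesis phi_summable : cvgn (series phi).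

(* With [g] close to [e / (4 * h n)], the term [g * h n] is at most [e / 4], while
   [p * phi p --> 0] makes [phi (g - n)] negligible against [h n]. *)
Lemma hit_count_error_small e : 0 < e -> \forall n \near \oo, exists2 g, (n <= g)%N &
  P (cylinder_at T A n x `&` [set y | (0 < hit_count T (cylinder_at T A n x) g y)%N])
    + phi (g - n)%N + h n * (g%:R * h n) <= h n * e.
Proof.
move=> e0; have [phi_dec _ _] := mu_mix.
pose v j := h (j %/ 2)%N + phi (j %/ 2)%N.
have hge0 m : 0 <= h m by exact: prob_ge0.
have v_ge0 j : 0 <= v j by rewrite addr_ge0 ?phi_ge0.
have sv : cvgn (series v).
  apply: is_cvg_seriesD; apply: (@summable_nondecreasing_index _ _ 2) => //.
  - exact: summable_prob_cylinder_at.
  - exact: phi_ge0.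
have e4 : 0 < e / 4 by lra.
have [r tail] := summable_tail v_ge0 sv e4.
(* Returns up to time [r.+2] are impossible for large [n]. Later times lie in the range where the
   tail of [v] is small and satisfy the condition [2 <= j] of [prob_return]. *)
have [n0 noret] := no_short_return part A_gen r.+2 x_nonper.
have nh := summable_nonincreasing_cvg0 prob_cylinder_at_decr hge0 summable_prob_cylinder_at.
have nphi := summable_nonincreasing_cvg0 phi_dec phi_ge0 phi_summable.
(* [n h(n) <= e / 8] will give [2 n <= g], so that the gap [g - n] is at least [g / 2]. *)
have e8 : 0 < e / 8 by lra.
(* For [p = g / 2] rounded down, [e / 4 < (g + 1) h(n) <= 4 p h(n)], that is [e < 16 p h(n)]. Hence
   [p phi(p) <= e^2 / 64] yields [phi(p) <= h(n) e / 4]. *)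
have e64 : 0 < e ^+ 2 / 64 by rewrite divr_gt0// exprn_gt0.
have [p0 _ /= phi_small] : \forall p \near \oo, p%:R * phi p <= e ^+ 2 / 64.
  move/cvgrPdist_le/(_ _ e64): nphi; apply: filterS => p.
  by rewrite sub0r normrN ger0_norm// mulr_ge0// phi_ge0.
near=> n.
have n1 : (1 <= n)%N by near: n; exact: nbhs_infty_ge.
have n_p0 : (p0 <= n)%N by near: n; exact: nbhs_infty_ge.
have n_n0 : (n0 <= n)%N by near: n; exact: nbhs_infty_ge.
have nh_small : n%:R * h n <= e / 8.
  near: n; move/cvgrPdist_le/(_ _ e8): nh; apply: filterS => n.
  by rewrite sub0r normrN ger0_norm// mulr_ge0.
have hn0 := prob_cylinder_at_gt0 n.
set E := cylinder_at T A n x.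
have quot_ge0 : 0 <= e / 4 / h n by rewrite divr_ge0 ?ltW.
pose g := Num.truncn (e / 4 / h n).
have /andP[g_le g_gt] := truncn_itv quot_ge0; rewrite -/g in g_le g_gt.
have gh : g%:R * h n <= e / 4 by rewrite -ler_pdivlMr.
have gh' : e / 4 < g.+1%:R * h n by rewrite -ltr_pdivrMr.
have ng : (n.*2 <= g)%N.
  rewrite -ltnS -(ltr_nat R); apply: le_lt_trans g_gt.
  by rewrite ler_pdivlMr// -muln2 natrM; lra.
exists g; first by apply: leq_trans ng; rewrite -addnn leq_addr.
have ngp : (n <= g %/ 2)%N by rewrite leq_divRL// muln2.
have phi_g : phi (g - n)%N <= h n * (e / 4).
  apply: (@le_trans _ _ (phi (g %/ 2)%N)).
    apply: phi_dec; rewrite leq_subRL ?(leq_trans ngp (leq_div _ _))//.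
    by apply: leq_trans (addn_divn2_le g); rewrite leq_add2r.
  have p1 : (0 < g %/ 2)%N by exact: leq_trans ngp.
  have := phi_small (g %/ 2)%N (leq_trans n_p0 ngp).
  have gp : g.+1%:R <= 4 * (g %/ 2)%:R :> R.
    by rewrite -natrM ler_nat ltn_mul4_divn2.
  have p0' : 0 < (g %/ 2)%:R :> R by rewrite ltr0n.
  have := lt_le_trans gh' (ler_wpM2r (ltW hn0) gp).
  move: ((g %/ 2)%:R : R) p0' (phi (g %/ 2)%N) => p p_gt0 f ehp fp.
  rewrite -(ler_pM2l p_gt0); apply: le_trans fp _; rewrite expr2.
  have := ler_wpM2r (ltW e0) (ltW ehp); lra.
have mE : measurable E by exact: measurable_cylinder_at.
have SE : cylinder_sigma E by exact: cylinder_sigma_cylinder_at.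
(* The total [h(n) e] is split into quarters: two for the returns, one for [phi (g - n)], one for
   the quadratic term. *)
suff returns : P (E `&` [set y | (0 < hit_count T E g y)%N]) <= h n * (g%:R * h n + e / 4).
  have := ler_wpM2l (ltW hn0) gh; lra.
apply: le_trans (prob_hit_count_gt0 g mE SE) _.
apply: (@le_trans _ _ (\sum_(1 <= j < g.+1) h n * (h n + (if (r <= j)%N then v j else 0)))).
  apply: ler_sum_nat => j /andP[j1 jg].
  have [jr|rj] := leqP j r.+2.
    rewrite noret ?j1// measure0/= mulr_ge0// addr_ge0//.
    by case: ifP.
  rewrite ifT; last by apply: leq_trans rj; rewrite -addn3 leq_addr.
  by apply: prob_return => //; exact: leq_trans rj.
rewrite -mulr_sumr ler_wpM2l// big_split/= sumr_const_nat subn1 -[_ *+ _]mulr_natl lerD//.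
apply: le_trans (tail g.+1).
rewrite -big_mkcond/= (big_nat_widenl r 0)//=.
rewrite [leRHS](big_cat_nat (n := 1))//= lerDr sumr_ge0//.
Unshelve. all: by end_near. Qed.

Lemma kth_hitting_time_cvg k (t : R) : 0 < t ->
  P [set y | ((t / h n)%:E < kth_hitting_time R T (cylinder_at T A n x) k.+1 y)%E]
    @[n --> \oo] --> \sum_(0 <= i < k.+1) expR (- t) * (t ^+ i / i`!%:R).
Proof.
move=> t0; pose N n := Num.truncn (t / h n).
pose G n k M := P [set y | (hit_count T (cylinder_at T A n x) M y < k)%N].
have GE n : P [set y | ((t / h n)%:E < kth_hitting_time R T (cylinder_at T A n x) k.+1 y)%E]
    = G n k.+1 (N n).
  congr (fine (mu _)); apply/seteqP; split=> y /lt_kth_hitting_time;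
    by apply; rewrite divr_ge0 ?ltW// prob_cylinder_at_gt0.
have bin_cvg := binomial_cdf_cvg prob_cylinder_at_gt0 prob_cylinder_at_cvg0 t0 (k := k.+1).
suff d0 : G n k.+1 (N n) - binomial_cdf (h n) k.+1 (N n) @[n --> \oo] --> 0.
  have Gcvg : G n k.+1 (N n) - binomial_cdf (h n) k.+1 (N n) + binomial_cdf (h n) k.+1 (N n)
      @[n --> \oo] --> 0 + \sum_(0 <= i < k.+1) expR (- t) * (t ^+ i / i`!%:R).
    exact: cvgD d0 bin_cvg.
  rewrite add0r (funext (fun n => subrK (binomial_cdf (h n) k.+1 (N n)) _)) in Gcvg.
  by rewrite (funext GE).
apply/cvgrPdist_le => e e0.
(* There are at most [t / h(n)] steps of the recursion, each costing [h(n) e / t], hence [e] in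
   all. *)
have et0 : 0 < e / t by rewrite divr_gt0.
near=> n; rewrite sub0r normrN.
have n1 : (1 <= n)%N by near: n; exact: nbhs_infty_ge.
have hn0 := prob_cylinder_at_gt0 n.
have [g ng err] : exists2 g, (n <= g)%N &
    P (cylinder_at T A n x `&` [set y | (0 < hit_count T (cylinder_at T A n x) g y)%N])
    + phi (g - n)%N + h n * (g%:R * h n) <= h n * (e / t).
  by near: n; exact: hit_count_error_small.
apply: le_trans (binomial_cdf_approx (eta := e / t) _ _ _ _ _ _) _.
- by rewrite ltW// prob_le1//; exact: measurable_cylinder_at.
- move=> M; rewrite /G (_ : [set y | _] = set0) ?measure0//.
  by apply/seteqP; split.
- move=> k'; rewrite /G (_ : [set y | _] = setT) ?prob_setT//.
  by apply/seteqP; split=> // y _ /=; rewrite hit_count0.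
- by move=> k' M; apply: le_trans err; exact: hit_count_cdf_step.
have /andP[Nt _] := truncn_itv (divr_ge0 (ltW t0) (ltW hn0)).
rewrite mulrA -[leRHS](divfK (lt0r_neq0 t0)) mulrC ler_wpM2l ?(ltW et0)//.
by rewrite -ler_pdivlMr.
Unshelve. all: by end_near. Qed.

End nonperiodic_point.

End right_mixing.

Theorem corollary1 (R : realType) (d : measure_display)
    (Omega : measurableType d) (mu : probability Omega R)
    (T : Omega -> Omega) (A : set (set Omega)) (phi : R^nat)
    (T_meas : measurable_fun [set: Omega] T)
    (mu_inv : invariant_measure T mu)
    (A_part : countable_measurable_partition A)
    (A_gen : generating T A)
    (mu_mix : right_phi_mixing T A mu phi)
    (phi_summable : cvgn (series phi))
    (x : Omega)
    (x_nonper : ~ periodic_point T x)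
    (x_pos : forall n : nat, (0 < mu (cylinder_at T A n x))%E)
    (k : nat) (k_ge1 : (1 <= k)%N) (t : R) (t_gt0 : 0 < t) :
  mu [set y | ((t / fine (mu (cylinder_at T A n x)))%:E
               < kth_hitting_time R T (cylinder_at T A n x) k y)%E]
    @[n --> \oo]
  --> (\sum_(0 <= i < k) expR (- t) * (t ^+ i / i`!%:R))%:E.
Proof.
case: k k_ge1 => // k _.
have h_gt0 n : 0 < fine (mu (cylinder_at T A n x)).
  exact: prob_cylinder_at_gt0.
apply: cvg_EFin; last exact: (kth_hitting_time_cvg (phi := phi)).
apply: nearW => n; apply: prob_fin_num.
(* Finiteness of the measure is obtained from measurability, which is visible once the event is
   expressed through visit counts. *)
have -> : [set y | ((t / fine (mu (cylinder_at T A n x)))%:E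
    < kth_hitting_time R T (cylinder_at T A n x) k.+1 y)%E] =
  [set y | (hit_count T (cylinder_at T A n x)
              (Num.truncn (t / fine (mu (cylinder_at T A n x)))) y < k.+1)%N].
  by apply/seteqP; split=> y /lt_kth_hitting_time; apply; rewrite divr_ge0 ?ltW.
apply: (cylinder_sigma_measurable T_meas A_part).
apply: cylinder_sigma_hit_count_lt => //.
exact: cylinder_sigma_cylinder_at.
Qed.
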